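(* Let $n\ge 1$, $1\le m\le n$ and $0\le t\le m-1$ be integers and consider the flag-shaped minimum blocker $B_n(m,t)$ of all $n\times n$ $123$-avoiding permutation matrices. Then the face of $\Omega_n(\overline{123})$ determined by $B_n(m,t)$ has dimension at most $(n-1)^2+1-t(n-m)$; that is, the maximum number of linearly independent (as real $n\times n$ matrices) $n\times n$ $123$-avoiding permutation matrices each of which has exactly one $1$ in a position of $B_n(m,t)$ is at most $(n-1)^2+1-t(n-m)$.
   Context: A permutation matrix $P$ contains a $123$-pattern if $I_3$ is a submatrix of $P$; otherwise $P$ is $123$-avoiding. $\Omega_n(\overline{123})$ denotes the polytope (convex hull) of the $n\times n$ $123$-avoiding permutation matrices. A set of positions is a blocker if every $n\times n$ $123$-avoiding permutation matrix has a $1$ in one of its positions, and it is minimum if removing any element makes it no longer a blocker. In this paper, the dimension of the face of $\Omega_n(\overline{123})$ determined by a minimum blocker $Q$ is taken to be the maximum number of linearly independent $123$-avoiding permutation matrices that intersect $Q$ exactly once (have exactly one $1$ in a position of $Q$). For integers $1\le m\le n$, $0\le t\le m-1$, the flag-shaped blocker $B_n(m,t)$ is the union of $\{(i,m): 1\le i\le n-t\}$ and $\{(i,j): 1\le i\le n-m+1,\ m-t\le j\le m-1\}$, positions written as (row, column). *)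

(* Defs.v *)
From HB Require Import structures.
From mathcomp Require Export all_boot all_order all_fingroup all_algebra.
From mathcomp Require Export reals.

Set Implicit Arguments.
Unset Strict Implicit.
Unset Printing Implicit Defensive.

Import Order.TTheory GRing.Theory Num.Theory.

Definition strictly_increasing (k n : nat) (f : {ffun 'I_k -> 'I_n}) : bool :=
  [forall a : 'I_k, forall b : 'I_k, (a < b) ==> (f a < f b)].

Definition contains123 (R : realType) (n : nat) (P : 'M[R]_n) : bool :=
  [exists f : {ffun 'I_3 -> 'I_n}, exists g : {ffun 'I_3 -> 'I_n},
    [&& strictly_increasing f, strictly_increasing g
      & mxsub f g P == 1%:M%R]].

Definition avoids123 (R : realType) (n : nat) (P : 'M[R]_n) : bool :=
  is_perm_mx P && ~~ contains123 P.

Definition meets_once (R : realType) (n : nat) (Q : {set 'I_n * 'I_n})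
    (P : 'M[R]_n) : bool :=
  #|[set p in Q | P p.1 p.2 == 1%R]| == 1.

(* Matrices over R do not form a finite type, so a set of permutation matrices
   is indexed by a set S of permutations, [perm_mx] being injective;
   [face_dim_ge] and [face_dim_attained] restate the maximum in terms of lists
   of matrices. *)
Definition independent_on_face (R : realType) (n : nat)
    (Q : {set 'I_n * 'I_n}) (S : {set 'S_n}) : bool :=
  free [seq (perm_mx s : 'M[R]_n) | s in S] &&
  [forall s in S, avoids123 (perm_mx s : 'M[R]_n) &&
                  meets_once Q (perm_mx s : 'M[R]_n)].

Definition face_dim (R : realType) (n : nat) (Q : {set 'I_n * 'I_n}) : nat :=
  \max_(S : {set 'S_n} | independent_on_face R Q S) #|S|.

(* Rows and columns of the source are numbered from 1, those of 'I_n from 0. *)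
Definition flag_blocker (n m t : nat) : {set 'I_n * 'I_n} :=
  [set p : 'I_n * 'I_n |
     ((p.2.+1 == m) && (1 <= p.1.+1 <= n - t))
  || ((1 <= p.1.+1 <= n - m + 1) && (m - t <= p.2.+1 <= m - 1))].

Lemma perm_mx_inj (R : realType) (n : nat) :
  injective (fun s : 'S_n => (perm_mx s : 'M[R]_n)).
Proof.
move=> s u /matrixP e; apply/permP=> i.
have := e i (s i); rewrite !mxE eqxx; case: eqP => [-> //|_] /=.
by move/eqP; rewrite oner_eq0.
Qed.

Lemma face_dim_ge (R : realType) (n : nat) (Q : {set 'I_n * 'I_n})
    (X : seq 'M[R]_n) :
  free X -> {in X, forall P, avoids123 P && meets_once Q P} ->
  size X <= face_dim R Q.
Proof.
move=> fX hX; pose S := [set s : 'S_n | (perm_mx s : 'M[R]_n) \in X].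
have pX : perm_eq X [seq (perm_mx s : 'M[R]_n) | s in S].
  apply: uniq_perm; first exact: free_uniq.
    by rewrite map_inj_uniq ?enum_uniq //; apply: perm_mx_inj.
  move=> P; apply/idP/imageP => [PX|[s sS ->]]; last by rewrite inE in sS.
  have /andP[/andP[/is_perm_mxP[s eP] _] _] := hX _ PX.
  by exists s; rewrite ?inE -?eP.
have eS : size X = #|S| by rewrite (perm_size pX) size_image.
rewrite eS; apply: leq_bigmax_cond.
rewrite /independent_on_face -(perm_free pX) fX /=.
by apply/forall_inP => s; rewrite inE => /hX.
Qed.

Lemma face_dim_attained (R : realType) (n : nat) (Q : {set 'I_n * 'I_n}) :
  exists X : seq 'M[R]_n,
    [/\ free X, {in X, forall P, avoids123 P && meets_once Q P}
      & size X = face_dim R Q].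
Proof.
have p0 : independent_on_face R Q set0.
  apply/andP; split; last by apply/forall_inP => s; rewrite inE.
  by rewrite /image_mem enum_set0 nil_free.
rewrite /face_dim (bigop.bigmax_eq_arg set0) //; case: arg_maxnP => //= S /andP[fS /forall_inP hS] _.
exists [seq (perm_mx s : 'M[R]_n) | s in S]; split; rewrite ?size_image //.
by move=> P /imageP[s /hS h ->].
Qed.

(* Main.v *)
Require Import Defs.
From mathcomp Require Import zify ring.

(** Number rows and columns from 1. A 123-avoiding permutation matrix P meeting
    B_n(m,t) exactly once vanishes on the t x (n-m) block of the last t rows and
    the last n-m columns. Indeed, suppose P has a 1 at (i,j) in that block. Of
    the t+1 columns m-t, ..., m exactly one has its 1 in the blocker, so the
    other t have theirs in the last m-1 rows; as row i is taken by column j,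
    one of them, c, has its 1 above the last t rows, in particular above
    (i,j). To avoid 123, every column left of c has its 1 below that of c.
    Hence m-1 of the first m columns, together with column j > m, have their 1s
    in the last m-1 rows, which is impossible.
    Finally, the matrices whose row and column sums are all 1 are determined by
    their entries outside the first row and the first column, where this block
    lies; so those that vanish on the block span a space of dimension at most
    (n-1)^2 + 1 - t(n-m). *)

Set Implicit Arguments.
Unset Strict Implicit.
Unset Printing Implicit Defensive.

Import GRing.Theory.

Lemma card_ord_interval (n a b : nat) :
  b <= n -> #|[set i : 'I_n | a <= i < b]| = b - a.
Proof.
move=> bn; rewrite cardsE cardE /enum_mem size_filter -enumT.
rewrite -(count_map (fun i : 'I_n => i : nat) (fun k => a <= k < b)).
rewrite val_enum_ord.
elim: b bn => [|b IHb] bn;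
  first by rewrite (@eq_count _ _ pred0) ?count_pred0 // => k; rewrite ltn0 andbF.
have := IHb (ltnW bn).
have -> : count (fun k => a <= k < b.+1) (iota 0 n)
        = count (fun k => a <= k < b) (iota 0 n)
          + count (predI (pred1 b) (fun=> a <= b)) (iota 0 n).
  rewrite -count_predUI [X in _ + X](@eq_count _ _ pred0) ?count_pred0 ?addn0.
    by apply: eq_count => k /=; lia.
  by move=> k /=; lia.
move=> ->; case: (leqP a b) => ab.
  rewrite (@eq_count _ _ (pred1 b)); last by move=> k /=; rewrite andbT.
  by rewrite count_uniq_mem ?iota_uniq // mem_iota; lia.
by rewrite (@eq_count _ _ pred0) ?count_pred0 => [|k] /=; lia.
Qed.

Lemma card_perm_interval (n a b : nat) (s : 'S_n) :
  b <= n -> #|[set i : 'I_n | a <= s i < b]| = b - a.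
Proof.
move=> bn; rewrite -(card_ord_interval a bn) -[RHS](card_preimset _ (@perm_inj _ s)).
by apply: eq_card => i; rewrite !inE.
Qed.

Lemma avoids123_perm (R : realType) (n : nat) (s : 'S_n) :
  avoids123 (perm_mx s : 'M[R]_n) ->
  forall i j k : 'I_n, i < j -> j < k -> s i < s j -> s j < s k -> False.
Proof.
move=> /andP[_ /negP av] i j k ij jk sij sjk; apply: av.
pose x := [tuple i; j; k].
apply/existsP; exists [ffun a => tnth x a].
apply/existsP; exists [ffun a => s (tnth x a)].
have incr (y : 3.-tuple 'I_n) : tnth y 0%R < tnth y 1%R -> tnth y 1%R < tnth y 2%R ->
    forall a b : 'I_3, a < b -> tnth y a < tnth y b.
  move=> y01 y12 a b.
  have e (c : 'I_3) : [\/ c = 0, c = 1 | c = 2]%R.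
    case: c => [[|[|[|c]]] c3] //; [constructor 1|constructor 2|constructor 3];
    exact: val_inj.
  by case: (e a) (e b) => -> [] -> //= _; apply: ltn_trans y12.
have xincr := incr x ij jk.
apply/and3P; split.
- by apply/forallP => a; apply/forallP => b; apply/implyP; rewrite !ffunE; apply: xincr.
- apply/forallP => a; apply/forallP => b; apply/implyP; rewrite !ffunE.
  by have := incr [tuple of map s x] sij sjk a b; rewrite !tnth_map.
- apply/eqP/matrixP => a b; rewrite !mxE !ffunE (inj_eq perm_inj).
  congr (_%:R)%R; congr nat_of_bool; apply/eqP/eqP => [e|-> //].
  apply: val_inj; case: (ltngtP a b) => // /xincr; rewrite e ltnn //.
Qed.

Lemma flag_blocker_zero_block (R : realType) (n m t : nat) (s : 'S_n) :
  m <= n -> t < m ->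
  avoids123 (perm_mx s : 'M[R]_n) ->
  meets_once (flag_blocker n m t) (perm_mx s : 'M[R]_n) ->
  forall i : 'I_n, n - t <= i -> m <= s i -> False.
Proof.
move=> mn tm /avoids123_perm av /cards1P[[r0 c0] hit] i it im.
(* A row other than [r0] misses the blocker; for column m itself, the bound then comes from
   [t < m]. *)
have good (r : 'I_n) : r != r0 -> m - t.+1 <= s r < m -> n - m < r.
  move=> rr0 sr; have /setP/(_ (r, s r)) := hit.
  rewrite !inE !mxE /= !xpair_eqE (negbTE rr0) [s r == s r]eqxx eqxx andbT /=.
  lia.
(* Pigeonhole: removing [r0] costs at most one row, and [i], whose 1 lies beyond column m, makes up
   for it. *)
have card_rows (a b : nat) : a <= m -> n - b <= i ->
    i |: ([set r : 'I_n | a <= s r < m] :\ r0) \subset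
      [set r : 'I_n | n - b <= r < n] -> m - a <= b.
  move=> am ib /subset_leq_card; rewrite card_ord_interval //.
  set A := [set r | _]; have iA : i \notin A :\ r0.
    by rewrite !inE [s i < m]ltnNge im !andbF.
  rewrite cardsU1 iA.
  have := cardsD1 r0 A; rewrite card_perm_interval //.
  lia.
(* Here [c] is a row. If it exists, too many 1s fall in the last m-1 rows; if not, too many fall in
   the last t rows. *)
have [|no] := boolP [exists c : 'I_n, [&& c != r0, m - t.+1 <= s c < m & c < n - t]].
  move=> /existsP[c /and3P[cr0 sc ct]].
  have cm := good c cr0 sc.
  suff : m - 0 <= m.-1 by lia.
  apply: card_rows => //; first by lia.
  apply/subsetP => r; rewrite !inE ltn_ord andbT => /orP[/eqP ->|/andP[rr0 srm]].
    lia.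
  suff : n - m < r by lia.
  case: (leqP (m - t.+1) (s r)) => sr; first by apply: good; rewrite ?rr0 ?sr.
  apply: (leq_trans cm); rewrite leqNgt; apply/negP => rc.
  by apply: (av r c i) => //; lia.
suff : m - (m - t.+1) <= t by lia.
apply: card_rows => //; first by lia.
apply/subsetP => r; rewrite !inE ltn_ord andbT => /orP[/eqP -> //|/andP[rr0 sr]].
rewrite leqNgt; apply/negP => rt; move/negP: no; apply.
by apply/existsP; exists r; rewrite rr0 sr.
Qed.

Section UnitLineSums.
Variables (F : fieldType) (n : nat).
Implicit Types (A : 'M[F]_n.+1) (D : {set 'I_n.+1 * 'I_n.+1}).
Local Open Scope ring_scope.

(* [corner_mx p] corrects the elementary matrix at [p] in the first row and the
   first column so that all its line sums are 0; it vanishes if [p] lies there.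
   [base_mx] has all its line sums equal to 1. *)
Definition corner_mx (p : 'I_n.+1 * 'I_n.+1) : 'M[F]_n.+1 :=
  \matrix_(i, j) (((i == p.1)%:R - (i == 0)%:R) * ((j == p.2)%:R - (j == 0)%:R)).

Definition base_mx : 'M[F]_n.+1 :=
  \matrix_(i, j) ((i == 0)%:R + (j == 0)%:R - (i == 0)%:R * (j == 0)%:R * n.+1%:R).

(** Expanding the product in [corner_mx] gives [A i j], less the row sum if [j = 0], less the column
    sum if [i = 0], plus the total [n.+1] at the corner: this is [A - base_mx]. *)
Lemma unit_line_sums_decomp A :
  (forall i, \sum_j A i j = 1) -> (forall j, \sum_i A i j = 1) ->
  A = base_mx + \sum_p A p.1 p.2 *: corner_mx p.
Proof.
move=> rA cA; apply/matrixP => i j; rewrite mxE summxE.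
rewrite -(pair_bigA _ (fun a b => (A a b *: corner_mx (a, b)) i j)) /=.
have sumD (G : 'I_n.+1 -> F) (k : 'I_n.+1) :
    \sum_a G a * ((k == a)%:R - (k == 0)%:R) = G k - (\sum_a G a) * (k == 0)%:R.
  under eq_bigr do rewrite mulrBr.
  rewrite sumrB mulr_suml (bigD1 k) //= eqxx mulr1 big1 ?addr0 // => a.
  by rewrite eq_sym => /negbTE ->; rewrite mulr0.
transitivity (base_mx i j + \sum_a (A a j - (j == 0)%:R) * ((i == a)%:R - (i == 0)%:R)).
  rewrite sumD sumrB cA sumr_const card_ord !mxE -mulr_natr; ring.
congr (_ + _); apply: eq_bigr => a _.
under eq_bigr => b _.
  rewrite !mxE /= mulrCA mulrC; over.
rewrite -mulr_suml sumD rA mul1r //.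
Qed.

(** In the decomposition, the coefficient vanishes on [D] and [corner_mx] vanishes on the first row
    and column; [base_mx] accounts for the extra 1. *)
Lemma free_unit_line_sums_leq D (X : seq 'M[F]_n.+1) :
  free X ->
  {in X, forall A, [/\ forall i, \sum_j A i j = 1, forall j, \sum_i A i j = 1
                     & {in D, forall p, A p.1 p.2 = 0}]} ->
  (size X <= #|setX [set~ 0%R] [set~ 0%R] :\: D|.+1)%N.
Proof.
set E := _ :\: D => fX hX.
pose Y := base_mx :: [seq corner_mx p | p in E].
suff XY : (<<X>> <= <<Y>>)%VS.
  rewrite -(eqnP fX); apply: leq_trans (dimvS XY) _.
  by apply: leq_trans (dim_span _) _; rewrite /= size_image.
apply/span_subvP => A /hX[rA cA zA].
rewrite (unit_line_sums_decomp rA cA); apply: rpredD.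
  by apply: memv_span; rewrite inE eqxx.
apply: rpred_sum => p _.
have [pE|] := boolP (p \in E).
  by apply/rpredZ/memv_span; rewrite inE image_f ?orbT.
rewrite !inE negb_and negbK => /orP[/zA ->|]; first by rewrite scale0r rpred0.
rewrite negb_and !negbK => p0.
suff -> : corner_mx p = 0 by rewrite scaler0 rpred0.
by apply/matrixP => i j; rewrite !mxE; case/orP: p0 => /eqP ->;
  rewrite subrr ?mul0r ?mulr0.
Qed.

End UnitLineSums.

Lemma perm_mx_row_sum (F : fieldType) (n : nat) (s : 'S_n) (i : 'I_n) :
  (\sum_j (perm_mx s : 'M[F]_n) i j = 1)%R.
Proof.
rewrite (bigD1 (s i)) //= !mxE eqxx big1 ?addr0 // => j.
by rewrite !mxE eq_sym => /negbTE ->.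
Qed.

Lemma perm_mx_col_sum (F : fieldType) (n : nat) (s : 'S_n) (j : 'I_n) :
  (\sum_i (perm_mx s : 'M[F]_n) i j = 1)%R.
Proof.
rewrite -(perm_mx_row_sum F (s^-1)%g j); apply: eq_bigr => i _.
by rewrite -tr_perm_mx [RHS]mxE.
Qed.

Theorem theorem4p4 (R : realType) (n m t : nat) :
  1 <= n -> 1 <= m <= n -> 0 <= t <= m - 1 ->
  ((face_dim R (flag_blocker n m t))%:Z
     <= (n%:Z - 1) ^+ 2 + 1 - t%:Z * (n%:Z - m%:Z))%R.
Proof.
case: n => [//|n] _ /andP[m0 mn] /andP[_ tm].
have [X [fX hX <-]] := face_dim_attained R (flag_blocker n.+1 m t).
pose D := setX [set i : 'I_n.+1 | n.+1 - t <= i < n.+1]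
               [set j : 'I_n.+1 | m <= j < n.+1].
have le : size X <= #|setX [set~ 0%R] [set~ 0%R] :\: D|.+1.
  apply: free_unit_line_sums_leq => // A AX.
  have /andP[av once] := hX A AX.
  have /andP[/is_perm_mxP[s eA] _] := av; subst A.
  split=> [i|j|[i j]]; [exact: perm_mx_row_sum|exact: perm_mx_col_sum|].
  rewrite !inE !ltn_ord !andbT !mxE /= => /andP[it jm].
  case: (s i =P j) => // sij; subst j; exfalso.
  by apply: (flag_blocker_zero_block mn _ av once it jm); lia.
have sub : D \subset setX [set~ 0%R] [set~ 0%R].
  apply/subsetP => -[i j]; rewrite !inE /= -!val_eqE /=; lia.
move: le; rewrite cardsDS // !cardsX !card_ord_interval // !cardsC1 card_ord /=.
have tn : t <= n by lia.
rewrite subKn; last by lia.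
(* With [n] now the size minus one, this keeps the natural subtraction from truncating. *)
have : t * (n.+1 - m) <= n * n by apply: leq_mul => //; lia.
have -> : ((n.+1%:Z - 1) ^+ 2 = (n * n)%N%:Z)%R by rewrite -natz -natr1 addrK natz.
have -> : (t%:Z * (n.+1%:Z - m%:Z) = (t * (n.+1 - m))%N%:Z)%R.
  by rewrite PoszM subzn.
lia.
Qed.
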